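(* $$\int_0^{\pi/2} e^{-\cos^2(x)}\,dx = \frac{\pi}{2}\,e^{-1/2}\, I_0\!\left(\frac{1}{2}\right).$$
   Context: For an integer $n$ and $\mathrm{Re}(z)>0$, $I_n(z)=\frac{1}{\pi}\int_0^{\pi} e^{z\cos\theta}\cos(n\theta)\,d\theta$ is the modified Bessel function of the first kind. *)

(* Defs.v *)
From Stdlib Require Import Reals.
From Coquelicot Require Import Coquelicot.
Local Open Scope R_scope.

Definition Cexp (z : C) : C :=
  (exp (Re z) * cos (Im z), exp (Re z) * sin (Im z)).

(** Modified Bessel function of the first kind of integer order [n].  The
    condition [0 < Re z] is not imposed: for integer [n] the integral converges
    for every [z]. *)
Definition besselI (n : Z) (z : C) : C :=
  (RtoC (/ PI) *
   RInt (V := C_R_CompleteNormedModule)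
     (fun theta : R =>
        (Cexp (z * RtoC (cos theta)) * RtoC (cos (IZR n * theta)))%C)
     0 PI)%C.

(* Main.v *)
(** The substitution [x = PI / 2 - theta / 2] turns [cos x] into
    [sin (theta / 2)], and [sin (theta / 2) ^ 2 = 1 / 2 - cos theta / 2]. *)

Require Import Defs.
From Stdlib Require Import Reals.
From Coquelicot Require Import Coquelicot.
Local Open Scope R_scope.

(** Under the half-angle substitution the exponent [- cos x ^ 2] becomes [- 1/2 + cos theta / 2],
    and [0..PI/2] is traversed backwards as [theta] runs over [0..PI]. Hence the integral of
    [exp (cos theta / 2)] over [0..PI] is [2 * exp (1/2)] times the integral sought
    ([is_RInt_exp_half_cos]). Divided by [PI], it is the Bessel value ([besselI_0_RtoC]). *)

Lemma Cexp_RtoC (x : R) : Cexp (RtoC x) = RtoC (exp x).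
Proof.
  unfold Cexp, RtoC; simpl; rewrite cos_0, sin_0; f_equal; ring.
Qed.

Lemma is_RInt_RtoC (f : R -> R) (a b l : R) :
  is_RInt f a b l ->
  is_RInt (V := C_R_NormedModule) (fun x => RtoC (f x)) a b (RtoC l).
Proof.
  intros Hf.
  apply (is_RInt_fct_extend_pair (U := R_NormedModule) (V := R_NormedModule)
           (fun x => RtoC (f x)) a b l 0 Hf).
  rewrite <- (Rmult_0_r (b - a)).
  exact (is_RInt_const (V := R_NormedModule) a b 0).
Qed.

(** At order 0 the cosine factor is [cos 0 = 1], and at a real argument [Cexp] is real, so the
    complex integral is a real one embedded by [RtoC]. *)
Lemma besselI_0_RtoC (x l : R) :
  is_RInt (fun theta => exp (x * cos theta)) 0 PI l ->
  besselI 0 (RtoC x) = RtoC (/ PI * l).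
Proof.
  intros Hl; unfold besselI.
  rewrite (is_RInt_unique (V := C_R_CompleteNormedModule) _ 0 PI (RtoC l)).
  - now rewrite RtoC_mult.
  - apply (is_RInt_ext (V := C_R_NormedModule) (fun theta => RtoC (exp (x * cos theta)))).
    + intros theta _.
      now rewrite <- RtoC_mult, Cexp_RtoC, Rmult_0_l, cos_0, Cmult_1_r.
    + now apply is_RInt_RtoC.
Qed.

Lemma cos_PI2_sub_half_sqr (theta : R) :
  cos (PI / 2 - theta / 2) ^ 2 = 1 / 2 - cos theta / 2.
Proof.
  rewrite cos_shift.
  replace (cos theta) with (cos (2 * (theta / 2))) by (f_equal; field).
  rewrite cos_2a_sin; field.
Qed.

Lemma ex_RInt_exp_opp_cos_sqr (a b : R) :
  ex_RInt (fun x => exp (- (cos x) ^ 2)) a b.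
Proof.
  apply (ex_RInt_continuous (V := R_CompleteNormedModule)); intros x _.
  apply (ex_derive_continuous (V := R_NormedModule)); auto_derive; exact I.
Qed.

Lemma is_RInt_exp_half_cos :
  is_RInt (fun theta => exp (1 / 2 * cos theta)) 0 PI
    (2 * exp (1 / 2) * RInt (fun x => exp (- (cos x) ^ 2)) 0 (PI / 2)).
Proof.
  set (f := fun x => exp (- (cos x) ^ 2)).
  (* The bounds are spelled as images of 0 and [PI] under the affine map, the shape
     [is_RInt_comp_lin] needs; the map is decreasing, hence the minus sign. *)
  assert (Hf : is_RInt f (- / 2 * 0 + PI / 2) (- / 2 * PI + PI / 2)
                 (- RInt f 0 (PI / 2))).
  { replace (- / 2 * 0 + PI / 2) with (PI / 2) by field.
    replace (- / 2 * PI + PI / 2) with 0 by field.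
    apply (is_RInt_swap (V := R_NormedModule)).
    apply (RInt_correct (V := R_CompleteNormedModule)), ex_RInt_exp_opp_cos_sqr. }
  apply (is_RInt_comp_lin (V := R_NormedModule)) in Hf.
  (* The factor [- 2] cancels the Jacobian [- / 2], and [exp (1 / 2)] cancels the constant part of
     the exponent. *)
  apply (is_RInt_scal (V := R_NormedModule) _ _ _ (- 2 * exp (1 / 2))) in Hf.
  replace (2 * exp (1 / 2) * RInt f 0 (PI / 2))
    with (scal (- 2 * exp (1 / 2)) (- RInt f 0 (PI / 2)))
    by (unfold scal; simpl; unfold mult; simpl; ring).
  revert Hf; apply (is_RInt_ext (V := R_NormedModule)); intros theta _.
  unfold scal; simpl; unfold mult; simpl; unfold f.
  replace (- / 2 * theta + PI / 2) with (PI / 2 - theta / 2) by field.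
  rewrite cos_PI2_sub_half_sqr.
  replace (1 / 2 * cos theta) with (1 / 2 + - (1 / 2 - cos theta / 2)) by field.
  rewrite exp_plus; field.
Qed.

Theorem theorem3p8 :
  RtoC (RInt (fun x : R => exp (- (cos x) ^ 2)) 0 (PI / 2)) =
  (RtoC (PI / 2 * exp (- (1 / 2))) * besselI 0%Z (RtoC (1 / 2)))%C.
Proof.
  rewrite (besselI_0_RtoC _ _ is_RInt_exp_half_cos), <- RtoC_mult.
  apply (f_equal RtoC).
  (* Only cancellation of [PI] and [exp (1 / 2)] remains, valid for any number [l] in place of the
     integral. *)
  enough (H : forall l : R,
            l = PI / 2 * exp (- (1 / 2)) * (/ PI * (2 * exp (1 / 2) * l)))
    by exact (H _).
  intros l; rewrite exp_Ropp; field.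
  split; [exact PI_neq0 | apply Rgt_not_eq, exp_pos].
Qed.
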